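(* Let $p\in(0,1)$ and $\beta>0$, let $\Xi_n$ be the position at time $n$ of the laziest elephant random walk with power law memory with parameters $(p,\beta)$, and let $\Xi_\infty=\lim_{n\to\infty}\Xi_n\in\mathbb{N}\cup\{+\infty\}$. Then $P(\Xi_\infty=k)>0$ for every $k\in\mathbb{N}=\{1,2,\dots\}$; in particular, $P(\Xi_n=1\text{ for all }n\in\mathbb{N})>0$.
   Context: For $n\in\mathbb{N}$ put $\mu_n:=\dfrac{\Gamma(n+\beta)}{\Gamma(n)\Gamma(\beta+1)}$. Laziest elephant random walk with power law memory, with parameters $p\in(0,1)$, $\beta>-1$: let $\{\beta_{n+1}:n\in\mathbb{N}\}$ be independent random variables with $$P(\beta_{n+1}=k)=\frac{\beta+1}{n}\cdot\frac{\mu_k}{\mu_{n+1}}\quad (1\le k\le n),$$ and $P(\beta_{n+1}=k)=0$ otherwise (this is a probability mass function). Set $X_1\equiv 1$ and, for $n\ge 1$, $X_{n+1}=X_{\beta_{n+1}}$ with probability $p$ and $X_{n+1}=0$ with probability $1-p$; that is, $X_{n+1}=\alpha_{n+1}X_{\beta_{n+1}}$, where the $\alpha_{n+1}$ are i.i.d. Bernoulli($p$) random variables independent of $\{\beta_{n+1}\}$. The walk is $\Xi_0=0$, $\Xi_n=\sum_{k=1}^n X_k$. *)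

(* Defs.v *)
From HB Require Import structures.
From mathcomp Require Import all_boot all_order all_algebra finmap.
From mathcomp Require Import all_classical all_reals all_analysis.

Set Implicit Arguments.
Unset Strict Implicit.
Unset Printing Implicit Defensive.

Import Order.TTheory GRing.Theory Num.Theory.
Import numFieldNormedType.Exports.

Local Open Scope classical_set_scope.
Local Open Scope ring_scope.

(* Euler's integral; it is only the Gamma function for 0 < x (for x <= 0 the
   integral diverges and Rintegral returns 0). *)
Definition Gamma (R : realType) (x : R) : R :=
  \int[@lebesgue_measure R]_(t in `]0, +oo[) (t `^ (x - 1) * expR (- t)).

(* Meaningful for 0 < n and -1 < beta. *)
Definition memory_weight (R : realType) (beta : R) (n : nat) : R :=
  Gamma (n%:R + beta) / (Gamma n%:R * Gamma (beta + 1)).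

Section independence.
Context d (T : measurableType d) (R : realType) (P : probability T R).

(* Mutual independence of the families of events F i, i in D. *)
Definition mutually_independent (I : choiceType) (D : set I)
    (F : I -> set (set T)) : Prop :=
  forall (J : {fset I}) (E : I -> set T),
    [set` J] `<=` D -> (forall i, i \in J -> F i (E i)) ->
    P (\bigcap_(i in [set` J]) E i) = (\prod_(i <- J) P (E i))%E.

Definition mutually_independent_RV d' (T' : measurableType d') (I : choiceType)
    (D : set I) (X : I -> {RV P >-> T'}) : Prop :=
  mutually_independent D (fun i => g_sigma_algebra_preimage (X i)).

(* The sigma-algebra generated by the X i, i in D. *)
Definition sigma_RV d' (T' : measurableType d') (I : Type)
    (D : set I) (X : I -> {RV P >-> T'}) : set (set T) :=
  <<s \bigcup_(i in D) g_sigma_algebra_preimage (X i) >>.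

Definition independent_sigma (F G : set (set T)) : Prop :=
  forall A B, F A -> G B -> P (A `&` B) = (P A * P B)%E.

End independence.

Section laziest_elephant.
Context d (T : measurableType d) (R : realType) (P : probability T R).

(* alpha and tau (the memory times beta_n) are only constrained at the indices
   n >= 2, and X at the indices n >= 1; indices start at 1 and the remaining
   values are irrelevant. *)
Record laziest_elephant (p beta : R) (alpha : nat -> {RV P >-> bool})
    (tau X : nat -> {RV P >-> nat}) : Prop := {
  memory_pmf : forall n k : nat, (1 <= n)%N ->
    P [set w | tau n.+1 w = k] =
    (if (1 <= k <= n)%N
     then (beta + 1) / n%:R *
          (memory_weight beta k / memory_weight beta n.+1)
     else 0)%:E ;
  memory_indep : mutually_independent_RV [set n | (2 <= n)%N] tau ;
  coin_bernoulli : forall n : nat, (1 <= n)%N ->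
    distribution P (alpha n.+1) =1 bernoulli_prob p ;
  coin_indep : mutually_independent_RV [set n | (2 <= n)%N] alpha ;
  coin_memory_indep :
    independent_sigma P (sigma_RV [set n | (2 <= n)%N] alpha)
                        (sigma_RV [set n | (2 <= n)%N] tau) ;
  step_first : forall w, X 1%N w = 1%N ;
  step_next : forall n w, (1 <= n)%N ->
    X n.+1 w = (alpha n.+1 w * X (tau n.+1 w) w)%N }.

Definition position (X : nat -> {RV P >-> nat}) (n : nat) (w : T) : nat :=
  (\sum_(1 <= k < n.+1) X k w)%N.

Definition limit_position (X : nat -> {RV P >-> nat}) (w : T) : \bar R :=
  limn (fun n => (position X n w)%:R%:E).

Lemma position_cvg (X : nat -> {RV P >-> nat}) w :
  (position X n w)%:R%:E @[n --> \oo] --> limit_position X w.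
Proof.
apply: ereal_nondecreasing_is_cvgn; apply/nondecreasing_seqP => n.
rewrite lee_fin ler_nat /position [leqRHS]big_nat_recr//=.
exact: leq_addr.
Qed.

Lemma limit_position_nat (X : nat -> {RV P >-> nat}) w : X 1%N w = 1%N ->
  limit_position X w = +oo%E \/
  exists2 k : nat, (1 <= k)%N & limit_position X w = k%:R%:E.
Proof.
move=> X1; set u := position X ^~ w.
have ndu m n : (m <= n)%N -> (u m <= u n)%N.
  by move=> mn; rewrite /u /position [leqRHS](@big_cat_nat _ _ _ m.+1)//= leq_addr.
case: (pselect (exists B : nat, forall n, (u n <= B)%N)) => [[B uB]|unB].
  right.
  have exu : exists k : nat, `[< exists n, u n = k >].
    by exists (u 0%N); apply/asboolP; exists 0%N.
  have bdu k : `[< exists n, u n = k >] -> (k <= B)%N.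
    by move=> /asboolP[n <-].
  case: (ex_maxnP exu bdu) => k /asboolP[N uN] maxk; exists k.
    apply: leq_trans (maxk (u 1%N) _); last by apply/asboolP; exists 1%N.
    by rewrite /u /position big_nat1 X1.
  apply/cvg_lim => //; apply: cvg_near_cst; exists N => // n /= Nn.
  congr (_%:R%:E); apply/eqP; rewrite eqn_leq maxk/=.
    by rewrite -uN; exact: ndu.
  by apply/asboolP; exists n.
left; apply/cvg_lim => //; apply/cvgeryP/cvgryPge => M.
have [N uN] : exists N, (Num.truncn M < u N)%N.
  apply/not_existsP => uM; apply: unB; exists (Num.truncn M) => n.
  by rewrite leqNgt; apply/negP; exact: uM.
exists N => // n /= Nn.
apply: le_trans (ltW (truncnS_gt M)) _.
by rewrite ler_nat (leq_trans uN)// ndu.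
Qed.

End laziest_elephant.

(* Main.v *)
Require Import Defs.
From mathcomp Require Import all_boot all_order all_algebra finmap.
From mathcomp Require Import all_classical all_reals all_analysis.
From mathcomp Require Import measurable_realfun ring.

Set Implicit Arguments.
Unset Strict Implicit.
Unset Printing Implicit Defensive.

Import Order.TTheory GRing.Theory Num.Theory.
Import numFieldNormedType.Exports.

Local Open Scope classical_set_scope.
Local Open Scope ring_scope.

(** Two independent pieces of randomness drive the walk: the coins [alpha] and the
    memory times [tau].  If the coins with index at most [k] succeed, those with
    index in [k+1, N] fail, and after time [N] the walker never recalls a time
    [<= k], then [X 1, ..., X k] are 1 and every later step is 0, because it
    either fails its coin or copies a step that is itself 0.  Hence the position
    at time [n] is [minn n k], and both claims reduce to showing that this event
    has positive probability for a suitable [N].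

    The coin part concerns finitely many independent coins, so its probability
    is a finite product of factors [p] and [1 - p].  For the memory part, let
    [q n] be the probability that [tau n.+1 <= k].  If the [q n] are summable, a
    union bound over the tail [n >= N] leaves positive probability as soon as
    [N] is large.

    Summability comes from the shape of the memory law alone.  With [mu] for the
    memory weights and [S n = mu 1 + ... + mu n], total mass one says
    [(beta + 1) * S n = n * mu n.+1], so [q n = S k / S n] for [n >= k] and the
    ratio [S n.+1 / S n] is [(n + 1 + beta) / n].  Thus
    [(n + 1 + beta) * q n.+1 = n * q n], that is
    [beta * q n.+1 = n * q n - n.+1 * q n.+1], which telescopes; positivity of
    [beta] then bounds the partial sums.  Normalisation of the law thus takes
    the place of the asymptotics of the gamma function. *)

(** * A telescoping summability criterion *)

(** Rewritten as [beta * u n.+1 = n * u n - n.+1 * u n.+1], the recurrence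
    makes [beta * (u 0 + ... + u n) + n * u n] constant from [k] on, so the
    partial sums are bounded. *)
Lemma small_tail_of_telescoping (R : realType) (u : nat -> R) (beta : R)
    (k : nat) : 0 < beta -> (forall n, 0 <= u n) ->
  (forall n, (k <= n)%N -> (n.+1%:R + beta) * u n.+1 = n%:R * u n) ->
  exists2 N, (k <= N)%N & (\sum_(N <= n <oo) (u n)%:E < 1)%E.
Proof.
move=> b0 u0 rec.
pose C := beta * \sum_(0 <= n < k.+1) u n + k%:R * u k.
have telescope n : beta * (\sum_(0 <= i < (k + n).+1) u i)
    + (k + n)%:R * u (k + n)%N = C.
  elim: n => [|n <-]; first by rewrite addn0.
  rewrite addnS big_nat_recr//= -(rec (k + n)%N) ?leq_addr//.
  ring.
have partial n : (\sum_(0 <= i < n) (u i)%:E <= (C / beta)%:E)%E.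
  rewrite sumEFin lee_fin ler_pdivlMr// mulrC.
  rewrite -(telescope n).
  apply: ler_wpDr; first by rewrite mulr_ge0.
  apply: ler_wpM2l; first exact: ltW.
  rewrite [leRHS](@big_cat_nat _ _ _ n)//=; last by rewrite leqW// leq_addl.
  by rewrite lerDl sumr_ge0.
have tail0 : (\sum_(N <= n <oo) (u n)%:E)%E @[N --> \oo] --> 0%E.
  apply: nneseries_tail_cvg => [|n _]; last by rewrite lee_fin.
  apply: (@le_lt_trans _ _ (C / beta)%:E); last exact: ltry.
  apply: lime_le; last exact: nearW.
  by apply: is_cvg_nneseries => n _ _; rewrite lee_fin.
have [[N1 _ N1P] /cvgrPdist_lt /(_ 1 ltr01)[N0 _ N0P]] := (fine_cvgP _ _).1 tail0.
exists (maxn k (maxn N0 N1)); first exact: leq_maxl.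
set N := maxn _ _.
have /N1P/= Nfin : (N1 <= N)%N by rewrite !leq_max leqnn !orbT.
have /N0P/= : (N0 <= N)%N by rewrite !leq_max leqnn !orbT.
rewrite sub0r normrN => /(le_lt_trans (ler_norm _)).
by rewrite -lte_fin fineK.
Qed.

(** * Natural-number-valued random variables *)

Section nat_valued.
Context d (T : measurableType d) (R : realType) (P : probability T R).

Lemma measurable_nat_event (Y : {RV P >-> nat}) (A : set nat) :
  measurable (Y @^-1` A).
Proof. by rewrite -[X in measurable X]setTI; exact: measurable_funP. Qed.

Lemma probability_nat_support (Y : {RV P >-> nat}) (n : nat) (A : pred nat) :
  (forall j, ~~ (1 <= j <= n)%N -> P [set w | Y w = j] = 0%E) ->
  P [set w | A (Y w)] = (\sum_(1 <= j < n.+1 | A j) P [set w | Y w = j])%E.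
Proof.
move=> Y0.
have -> : [set w | A (Y w)] = \bigcup_(j in A) [set w | Y w = j].
  by apply/seteqP; split => [w Aw|w [j Aj /= ->]//]; exists (Y w).
rewrite measure_bigcup; last 2 first.
- by move=> j _; exact: (measurable_nat_event Y [set j]).
- by move=> i j _ _ [w [/= <- <-]].
rewrite eseries_mkcond (@nneseries_split _ _ 0 n.+1); last first.
  by move=> j _; case: ifP.
rewrite add0n eseries0 ?adde0; last first.
  by move=> j nj _; case: ifP => // _; rewrite [LHS]Y0// negb_and -!ltnNge nj orbT.
rewrite big_nat_recl//= [X in if _ then X else _]Y0// if_same add0e.
rewrite [RHS]big_mkcond/= big_add1.
by apply: eq_bigr => i _; rewrite mem_setE.
Qed.

Lemma measurable_position (X : nat -> {RV P >-> nat}) (n : nat) :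
  measurable_fun setT (fun w => (position X n w)%:R : R).
Proof.
rewrite (_ : (fun w => _) = fun w => \sum_(1 <= k < n.+1) (X k w)%:R); last first.
  by apply/funext => w; rewrite /position natr_sum.
apply: measurable_sum => k.
exact: (@measurableT_comp _ _ _ _ _ _ (fun m : nat => m%:R : R)).
Qed.

Lemma measurable_limit_position (X : nat -> {RV P >-> nat}) :
  measurable_fun setT (limit_position X).
Proof.
apply: (emeasurable_fun_cvg (fun n w => (position X n w)%:R%:E)) => [n|w _].
  by apply/measurable_EFinP; exact: measurable_position.
exact: position_cvg.
Qed.

End nat_valued.

(** * Countable intersections in a generated sigma-algebra *)

Section generated.
Context d (T : measurableType d) (R : realType) (P : probability T R).
Context d' (T' : measurableType d').

Lemma sigma_RV_bigcap (D : set nat) (Y : nat -> {RV P >-> T'})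
    (B : nat -> set T') : (forall n, D n -> measurable (B n)) ->
  sigma_RV D Y (\bigcap_(n in D) (Y n @^-1` B n)).
Proof.
move=> mB; rewrite -[X in sigma_RV _ _ X]setCK setC_bigcap.
have [S0 SC SU] : sigma_algebra setT (sigma_RV D Y).
  exact: smallest_sigma_algebra.
rewrite -setTD; apply: (SC).
rewrite bigcup_mkcond; apply: SU => n; case: ifPn => [/set_mem Dn|//].
rewrite -setTD; apply: (SC); apply: sub_sigma_algebra; exists n => //.
by exists (B n); [exact: mB|rewrite setTI].
Qed.

End generated.

(** * The memory law and the events on which the walk stops *)

Section laziest_elephant.
Context d (T : measurableType d) (R : realType) (P : probability T R).
Context (p beta : R) (alpha : nat -> {RV P >-> bool})
  (tau X : nat -> {RV P >-> nat})
  (hX : laziest_elephant p beta alpha tau X).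

Lemma probability_memory (A : pred nat) (n : nat) : (1 <= n)%N ->
  P [set w | A (tau n.+1 w)] =
  ((beta + 1) / n%:R / memory_weight beta n.+1 *
   \sum_(1 <= j < n.+1 | A j) memory_weight beta j)%:E.
Proof.
move=> n0; rewrite (@probability_nat_support _ _ _ _ _ n); last first.
  by move=> j /negbTE nj; rewrite (memory_pmf hX)// nj.
rewrite mulr_sumr -sumEFin big_nat_cond [RHS]big_nat_cond.
apply: eq_bigr => j /andP[]; rewrite ltnS => jn _.
by rewrite (memory_pmf hX)// jn; congr (_%:E); ring.
Qed.

(** Both sides share the factor [mu 1 + ... + mu k], so only the normalising
    constants matter.  These are read off from the total mass of the laws of
    [tau n.+1] and [tau n.+2]; total mass one also forces the weights in the
    denominators to be nonzero. *)
Lemma probability_recall_recurrence (k n : nat) : 0 < beta ->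
  (1 <= k <= n)%N ->
  (n.+1%:R + beta) * fine (P [set w | (tau n.+2 w <= k)%N]) =
  n%:R * fine (P [set w | (tau n.+1 w <= k)%N]).
Proof.
move=> b0 /andP[k0 kn].
have n0 : (1 <= n)%N by exact: leq_trans kn.
rewrite !(probability_memory (fun t => t <= k)%N)//=.
have Tot m : (1 <= m)%N -> (beta + 1) / m%:R / memory_weight beta m.+1 *
    \sum_(1 <= j < m.+1) memory_weight beta j = 1.
  move=> m0; apply: EFin_inj; rewrite -(probability_memory predT)//.
  rewrite (_ : [set w | _] = setT) ?probability_setT//.
  by apply/seteqP.
have low m : (k <= m)%N -> \sum_(1 <= j < m.+1 | (j <= k)%N) memory_weight beta j
    = \sum_(1 <= j < k.+1) memory_weight beta j.
  by move=> km; rewrite [RHS](@big_nat_widen _ _ _ _ _ m.+1).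
rewrite !low ?leqW// !mulrA; congr (_ * _).
have := Tot n n0; have := Tot n.+1 isT.
rewrite (@big_nat_recr _ _ _ n.+1)//=.
set s := \sum_(1 <= _ < _) _; set x := memory_weight beta n.+1.
set y := memory_weight beta n.+2 => e2 e1.
have x0 : x != 0.
  by apply: contra_eq_neq e1 => ->; rewrite invr0 mulr0 mul0r eq_sym oner_eq0.
have y0 : y != 0.
  by apply: contra_eq_neq e2 => ->; rewrite invr0 mulr0 mul0r eq_sym oner_eq0.
have n0' : n%:R != 0 :> R by rewrite pnatr_eq0 -lt0n.
have n1' : n.+1%:R != 0 :> R by rewrite pnatr_eq0.
have b1 : beta + 1 != 0 by rewrite gt_eqF// addr_gt0.
have {}e1 : (beta + 1) * s = n%:R * x.
  transitivity (n%:R * x * ((beta + 1) / n%:R / x * s)); last by rewrite e1 mulr1.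
  by field; rewrite x0 n0'.
have {}e2 : (beta + 1) * (s + x) = n.+1%:R * y.
  transitivity (n.+1%:R * y * ((beta + 1) / n.+1%:R / y * (s + x))).
    by field; rewrite y0 nat1r n1'.
  by rewrite e2 mulr1.
have {e1}e2 : n.+1%:R * y = (n.+1%:R + beta) * x.
  by rewrite -e2 mulrDr e1 -natr1; ring.
have -> : y = (n.+1%:R + beta) * x / n.+1%:R by rewrite -e2 mulrAC mulfV// mul1r.
have nb : n.+1%:R + beta != 0 by rewrite gt_eqF// addr_gt0// ltr0n.
field.
by rewrite x0 n0' nat1r ?n1' nb.
Qed.

(** Values allowed for the memory time [tau n.+1].  Before time [N] the only
    requirement is that it lie in its support [1, n]: the law excludes other
    values only almost surely, whereas the pathwise induction on the steps needs
    it at every point. *)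
Definition recent (k N n t : nat) : bool :=
  ((if N <= n then k else 0) < t <= n)%N.

Definition memory_event (k N : nat) : set T :=
  \bigcap_(n in [set n | (2 <= n)%N]) (tau n @^-1` recent k N n.-1).

Definition coin_event (k N : nat) : set T :=
  \bigcap_(n in [set n | (2 <= n)%N])
    (alpha n @^-1` [set b | (n <= N)%N -> b = (n <= k)%N]).

(** Union bound over [n]: for [n < N] the forbidden values of [tau n.+1] carry
    no mass, and for [N <= n] their mass is the probability of recalling a time
    [<= k], whose sum is below 1 for large [N]. *)
Lemma memory_event_gt0 (k : nat) : 0 < beta -> (1 <= k)%N ->
  exists2 N, (k <= N)%N & (0 < P (memory_event k N))%E.
Proof.
move=> b0 k0.
pose q n := fine (P [set w | (tau n.+1 w <= k)%N]).
have q0 n : 0 <= q n by rewrite fine_ge0.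
have rec n : (k <= n)%N -> (n.+1%:R + beta) * q n.+1 = n%:R * q n.
  by move=> kn; rewrite probability_recall_recurrence// k0.
have [N kN tail1] := small_tail_of_telescoping b0 q0 rec.
exists N => //.
(* The first memory time is [tau 2], so [n = 0] must contribute nothing. *)
pose F n := if (1 <= n)%N then tau n.+1 @^-1` (~` recent k N n) else set0.
have mF n : measurable (F n).
  by rewrite /F; case: ifP => // _; exact: measurable_nat_event.
have BE : memory_event k N = ~` \bigcup_n F n.
  apply/seteqP; split => w h.
    by move=> [n _]; rewrite /F; case: ifP => // n0; apply; exact: (h n.+1).
  move=> [|[|n]]// _ /=; apply: contrapT => nr; apply: h.
  by exists n.+1.
have mB : measurable (memory_event k N).
  by rewrite BE; apply: measurableC; exact: bigcupT_measurable.
have PF n : (P (F n) <= if (N <= n)%N then (q n)%:E else 0)%E.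
  rewrite /F; case: ifP => [n0|/negbT]; last first.
    by rewrite -leqNgt => n0; rewrite measure0; case: ifP => // _; rewrite lee_fin.
  rewrite (_ : _ @^-1` _ = [set w | ~~ recent k N n (tau n.+1 w)]); last first.
    by apply/seteqP; split => w /= /negP.
  rewrite (probability_memory (fun t => ~~ recent k N n t))// big_nat_cond.
  case: ifP => Nn; last first.
    rewrite big_pred0 ?mulr0// => j.
    by rewrite /recent Nn ltnS andbN.
  rewrite /q (probability_memory (fun t => t <= k)%N)//= [in leRHS]big_nat_cond.
  rewrite le_eqVlt; apply/orP; left; apply/eqP; congr (_ * _)%:E.
  apply: eq_bigl => j; rewrite /recent Nn ltnS.
  by case: (j <= n)%N; rewrite ?andbF// !andbT -leqNgt.
rewrite -[memory_event k N]setCK probability_setC; last exact: measurableC.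
rewrite sube_gt0 BE setCK; apply: le_lt_trans tail1.
apply: (@le_trans _ _ (\sum_(n <oo) P (F n))%E).
  by apply: measure_sigma_subadditive => //; exact: bigcupT_measurable.
rewrite [leRHS]eseries_cond/= [leRHS]eseries_mkcond.
by apply: lee_nneseries => // n _; exact: PF.
Qed.

(** Only the coins with index in [2, N] are constrained, so this is a finite
    intersection of independent events, each of probability [p] or [1 - p]. *)
Lemma coin_event_gt0 (k N : nat) : 0 < p < 1 -> (0 < P (coin_event k N))%E.
Proof.
move=> /andP[p0 p1].
pose J : {fset nat} := [fset i in iota 2 N.-1]%fset.
pose E i := alpha i @^-1` [set (i <= k)%N].
have JE i : (i \in J) = (2 <= i <= N)%N.
  rewrite !inE mem_iota; case: N J => [|N'] J.
    by rewrite addn0; case: i => [|[|]].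
  by rewrite /= addnC addn2 ltnS.
have -> : coin_event k N = \bigcap_(i in [set` J]) E i.
  apply/seteqP; split => w h i.
    by rewrite /= JE => /andP[i2 iN]; exact: h.
  by move=> /= i2 iN; apply: h; rewrite /= JE i2.
have PE i : i \in J -> P (E i) = (if (i <= k)%N then p else 1 - p)%:E.
  rewrite JE; case: i => [|[|i]]//= _.
  have := coin_bernoulli hX (isT : 1 <= i.+1)%N [set (i.+2 <= k)%N].
  rewrite /E /distribution /pushforward => ->.
  rewrite bernoulli_probE ?ltW//.
  case: leqP => _; rewrite !diracE !classical_sets.in_set1/=;
    rewrite ?mule1 ?mule0 ?adde0 ?add0e//.
rewrite (coin_indep hX) => [|i|i iJ].
- rewrite (eq_big_seq (fun i => (if (i <= k)%N then p else 1 - p)%:E))//.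
  rewrite prodEFin lte_fin prodr_gt0// => i _.
  by case: ifP => // _; rewrite subr_gt0.
- by rewrite /= JE => /andP[].
- by exists [set (i <= k)%N] => //; rewrite setTI.
Qed.

(** Strong induction on [n]: the recalled step has an earlier index.  Up to time
    [N] the coin decides, and a success occurs only while every earlier step is
    1; after time [N] the recalled index exceeds [k], so the recalled step
    is 0 whatever the coin. *)
Lemma steps_on_events (k N n : nat) (w : T) : (1 <= k <= N)%N ->
  coin_event k N w -> memory_event k N w ->
  (1 <= n)%N -> X n w = (n <= k)%N.
Proof.
move=> /andP[k0 kN] coinw memw.
elim/ltn_ind: n => -[//|[|n]] IH _; first by rewrite (step_first hX) k0.
rewrite (step_next hX)//.
have := memw n.+2 isT; rewrite /= /recent /= => /andP[lot tn].
have t0 : (1 <= tau n.+2 w)%N by exact: leq_ltn_trans lot.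
rewrite IH//.
have [nN|Nn] := ltnP n.+1 N.
  rewrite (coinw n.+2 isT nN).
  case: (leqP n.+2 k) => // nk; rewrite mul1n.
  by rewrite (leq_trans tn)// ltnW.
rewrite Nn in lot.
by rewrite leqNgt lot muln0 leqNgt ltnS (leq_trans kN).
Qed.

Lemma position_on_events (k N n : nat) (w : T) : (1 <= k <= N)%N ->
  coin_event k N w -> memory_event k N w -> position X n w = minn n k.
Proof.
move=> kN coinw memw; rewrite /position.
elim: n => [|n IH]; first by rewrite big_geq// min0n.
rewrite big_nat_recr//= IH (steps_on_events kN)//.
rewrite /minn; case: (ltnP n k) => nk.
  rewrite addn1; case: ltnP => // h; apply/eqP; rewrite eqn_leq nk.
  by [].
by rewrite addn0 ltnNge leqW.
Qed.

Lemma events_gt0 (k : nat) : 0 < p < 1 -> 0 < beta -> (1 <= k)%N ->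
  exists2 N, (k <= N)%N & (0 < P (coin_event k N `&` memory_event k N))%E.
Proof.
move=> p01 b0 k0; have [N kN PN] := memory_event_gt0 b0 k0.
exists N => //; rewrite (coin_memory_indep hX).
- by rewrite mule_gt0// coin_event_gt0.
- exact: sigma_RV_bigcap.
- exact: sigma_RV_bigcap.
Qed.

Lemma probability_of_position_gt0 (k : nat) (A : set T) :
  0 < p < 1 -> 0 < beta -> (1 <= k)%N -> measurable A ->
  [set w | forall n, position X n w = minn n k] `<=` A -> (0 < P A)%E.
Proof.
move=> p01 b0 k0 mA sA; have [N kN PN] := events_gt0 p01 b0 k0.
apply: lt_le_trans PN _; apply: le_measure; rewrite ?inE//.
  apply: measurableI; apply: bigcap_measurable => [|n _]; try by exists 2%N.
    by rewrite -[X in measurable X]setTI; exact: measurable_funP.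
  exact: measurable_nat_event.
move=> w [cw mw]; apply: sA => n; apply: (position_on_events n _ cw mw).
by rewrite k0.
Qed.

End laziest_elephant.

Theorem theorem2p4 (R : realType) (d : measure_display) (T : measurableType d)
    (P : probability T R) (p beta : R) (alpha : nat -> {RV P >-> bool})
    (tau X : nat -> {RV P >-> nat})
    (hp : 0 < p < 1) (hbeta : 0 < beta)
    (hX : laziest_elephant p beta alpha tau X) :
  (forall k : nat, (1 <= k)%N ->
     (0 < P [set w | limit_position X w = k%:R%:E])%E) /\
  (0 < P [set w | forall n : nat, (1 <= n)%N -> position X n w = 1%N])%E.
Proof.
split=> [k k0|].
  apply: (probability_of_position_gt0 hX hp hbeta k0) => [|w pw].
    rewrite -[X in measurable X]setTI.
    have := measurable_limit_position X measurableT (emeasurable_set1 k%:R%:E).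
    exact.
  apply/cvg_lim => //; apply: cvg_near_cst; exists k => // n /= kn.
  by rewrite pw (minn_idPr kn).
apply: (probability_of_position_gt0 hX hp hbeta (isT : 1 <= 1)%N) => [|w pw].
  rewrite (_ : [set w | _] = \bigcap_(n in [set n | (1 <= n)%N])
      ((fun w => (position X n w)%:R : R) @^-1` [set 1])).
    apply: bigcap_measurable => [|n _]; first by exists 1%N.
    rewrite -[X in measurable X]setTI.
    exact: (measurable_position X n measurableT (measurable_set1 1)).
  apply/seteqP; split => w h n n1 /=; first by rewrite h.
  by apply/eqP; rewrite -(eqr_nat R); apply/eqP; exact: h.
by move=> n n1; rewrite pw (minn_idPr n1).
Qed.
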